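(* Let $\mathbb{J}$, $\mathbb{D}$, $\mathbb{M}$ be classes of filters. (1) Let $\mathbb{M}$ be $\mathbb{F}_1$-steady and projectable. If $\mathcal{J}\times\mathcal{D}\in\mathbb{M}$ for every $\mathcal{J}\in\mathbb{J}$ and every $\mathcal{D}\in\mathbb{D}$, then $\mathbb{J}$ is $(\mathbb{D},\mathbb{M})$-steady. (2) Let $\mathbb{M}$ be projectable and $\mathbb{J}$ be $\mathbb{F}_1$-composable. If $\mathbb{J}$ is $(\mathbb{D},\mathbb{M})$-steady, then $\mathbb{J}$ is $(\mathbb{D},\mathbb{M})$-composable. (3) Let $\mathbb{D}$ be $\mathbb{F}_1$-composable. If $\mathbb{J}$ is $(\mathbb{D},\mathbb{M})$-composable, then $\mathcal{J}\times\mathcal{D}\in\mathbb{M}$ for every $\mathcal{J}\in\mathbb{J}$ and every $\mathcal{D}\in\mathbb{D}$. (4) Let $\mathbb{M}$ be $\mathbb{F}_1$-steady and projectable. If either $\mathbb{D}$ or $\mathbb{J}$ is $\mathbb{F}_1$-composable, then $\mathcal{J}\times\mathcal{D}\in\mathbb{M}$ for every $\mathcal{J}\in\mathbb{J}$ and every $\mathcal{D}\in\mathbb{D}$ if and only if $\mathcal{J}\times\mathcal{D}\in\ker(\mathbb{M})$ for every $\mathcal{J}\in\mathbb{J}$ and every $\mathcal{D}\in\mathbb{D}$.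
   Context: Filters are proper. A class $\mathbb{J}$ of filters prescribes for each set $X$ a set $\mathbb{J}(X)$ of filters on $X$. $\mathbb{F}_1$ is the class of principal filters $A^\uparrow=\{B\subseteq X: A\subseteq B\}$ ($A\neq\varnothing$); a set is identified with its principal filter. Two families of sets mesh, $\mathcal{F}\#\mathcal{G}$, if $F\cap G\ne\varnothing$ for all $F\in\mathcal{F}$, $G\in\mathcal{G}$. If filters $\mathcal{F},\mathcal{G}$ mesh, $\mathcal{F}\vee\mathcal{G}$ is the filter generated by the sets $F\cap G$. $\mathcal{J}\times\mathcal{D}$ is the filter (on the product of the underlying sets, which are arbitrary and possibly different) generated by the sets $J\times D$. For a filter $\mathcal{F}$ on $X$ and a filter $\mathcal{H}$ on $X\times Y$ with $\mathcal{H}\#(\mathcal{F}\times Y)$, $\mathcal{H}\mathcal{F}$ is the filter on $Y$ generated by the sets $HF=\{y:\exists x\in F,\ (x,y)\in H\}$, $H\in\mathcal{H}$, $F\in\mathcal{F}$. $\mathbb{J}$ is $(\mathbb{D},\mathbb{M})$-steady if $\mathcal{F}\vee\mathcal{H}\in\mathbb{M}(X)$ whenever $\mathcal{F}\in\mathbb{J}(X)$, $\mathcal{H}\in\mathbb{D}(X)$ and $\mathcal{F}\#\mathcal{H}$; $\mathbb{M}$ is $\mathbb{F}_1$-steady if it is $(\mathbb{F}_1,\mathbb{M})$-steady. $\mathbb{J}$ is $(\mathbb{D},\mathbb{M})$-composable if $\mathcal{H}\mathcal{F}\in\mathbb{M}(Y)$ for all sets $X,Y$, all $\mathcal{F}\in\mathbb{J}(X)$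 and all $\mathcal{H}\in\mathbb{D}(X\times Y)$ with $\mathcal{H}\#(\mathcal{F}\times Y)$; $\mathbb{J}$ is $\mathbb{F}_1$-composable if it is $(\mathbb{F}_1,\mathbb{J})$-composable. $\mathbb{M}$ is projectable if $\pi_Y(\mathcal{F})\in\mathbb{M}(Y)$ for all sets $X,Y$ and all $\mathcal{F}\in\mathbb{M}(X\times Y)$, where $\pi_Y$ is the projection onto $Y$; products of sets are identified up to canonical reordering and re-association of factors, so that this applies to projection onto any factor. $\ker(\mathbb{M})$ is the class of filters $\mathcal{F}$ (on a set $X$) such that $A\mathcal{F}\in\mathbb{M}(Y)$ for every set $Y$ and every $A\subseteq X\times Y$ with $A\#(\mathcal{F}\times Y)$. *)

(* Defs.v *)
(* MathComp: sets and filters of mathcomp-classical. *)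
From mathcomp Require Import all_boot.
From mathcomp Require Import boolp classical_sets filter.

Set Implicit Arguments.
Unset Strict Implicit.
Unset Printing Implicit Defensive.

Local Open Scope classical_set_scope.

(* Sets are modelled by types, which may be empty; subsets of X by [set X].
   The principal filter of A is [globally A]; in particular a whole set Y,
   seen as a filter, is [globally [set: Y]].  [globally set0] is improper, but
   it never meshes with a filter. *)

Record filters_class := FiltersClass {
  mem_class :> forall X : Type, set (set_system X);
  mem_class_proper :
    forall (X : Type) (F : set_system X), mem_class F -> ProperFilter F }.
Arguments mem_class : clear implicits.

Lemma principal_proper (X : Type) (F : set_system X) :
  (exists2 A : set X, A !=set0 & F = globally A) -> ProperFilter F.
Proof. by case=> A [a Aa] ->; exact: globally_properfilter Aa. Qed.

Definition F1 : filters_class :=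
  @FiltersClass
    (fun X => [set F | exists2 A : set X, A !=set0 & F = globally A])
    principal_proper.

Definition filter_join (X : Type) (F G : set_system X) : set_system X :=
  filter_from [set P : set X * set X | F P.1 /\ G P.2]
              (fun P => P.1 `&` P.2).

Definition rel_image (X Y : Type) (H : set (X * Y)) (F : set X) : set Y :=
  [set y | exists2 x, F x & H (x, y)].

Definition filter_relimage (X Y : Type) (H : set_system (X * Y))
    (F : set_system X) : set_system Y :=
  filter_from [set P : set (X * Y) * set X | H P.1 /\ F P.2]
              (fun P => rel_image P.1 P.2).

Lemma filter_join_proper (X : Type) (F G : set_system X) :
  Filter F -> Filter G -> F `#` G -> ProperFilter (filter_join F G).
Proof.
move=> FF FG FG0; apply: filter_from_proper.
  apply: filter_from_filter.
    by exists (setT, setT); split; exact: filterT.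
  move=> [A B] [C D] /= [FA GB] [FC GD]; exists (A `&` C, B `&` D).
    by split; exact: filterI.
  by move=> x [[? ?] [? ?]].
by move=> [A B] [/= FA GB]; exact: FG0.
Qed.

Lemma filter_relimage_proper (X Y : Type) (H : set_system (X * Y))
    (F : set_system X) : Filter H -> Filter F ->
  H `#` filter_prod F (globally [set: Y]) -> ProperFilter (filter_relimage H F).
Proof.
move=> FH FF HF; apply: filter_from_proper.
  apply: filter_from_filter.
    by exists (setT, setT); split; exact: filterT.
  move=> [A B] [C D] /= [HA FB] [HC FD]; exists (A `&` C, B `&` D).
    by split; exact: filterI.
  by move=> y [x [? ?] [? ?]]; split; exists x.
move=> [A B] [/= HA FB]; have [|[x y] [Axy [Bx _]]] := HF A (B `*` setT) HA.
  by exists (B, setT).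
by exists y, x.
Qed.

(* [steady D M J] and [composable D M J] read: J is (D, M)-steady, resp.
   (D, M)-composable. *)
Definition steady (D M J : filters_class) : Prop :=
  forall (X : Type) (F H : set_system X),
    J X F -> D X H -> F `#` H -> M X (filter_join F H).

Definition F1_steady (M : filters_class) : Prop := steady F1 M M.

Definition composable (D M J : filters_class) : Prop :=
  forall (X Y : Type) (F : set_system X) (H : set_system (X * Y)),
    J X F -> D (X * Y)%type H -> H `#` filter_prod F (globally [set: Y]) ->
    M Y (filter_relimage H F).

Definition F1_composable (J : filters_class) : Prop := composable F1 J J.

(* Types offer no identification of X * Y with Y * X, so both projections are
   required; projections of iterated products onto one factor are composites
   of these. *)
Definition projectable (M : filters_class) : Prop :=
  forall (X Y : Type) (F : set_system (X * Y)),
    M (X * Y)%type F -> M X (fst @ F) /\ M Y (snd @ F).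

Definition in_ker (M : filters_class) (X : Type) : set (set_system X) :=
  [set F | ProperFilter F /\
    forall (Y : Type) (A : set (X * Y)),
      globally A `#` filter_prod F (globally [set: Y]) ->
      M Y (filter_relimage (globally A) F)].

Lemma in_ker_proper (M : filters_class) (X : Type) (F : set_system X) :
  in_ker M F -> ProperFilter F.
Proof. by case. Qed.

Definition ker (M : filters_class) : filters_class :=
  FiltersClass (@in_ker_proper M).

Definition products_in (J D M : filters_class) : Prop :=
  forall (X Y : Type) (F : set_system X) (G : set_system Y),
    J X F -> D Y G -> M (X * Y)%type (filter_prod F G).

(* Main.v *)
Require Import Defs.
From mathcomp Require Import all_boot.
From mathcomp Require Import boolp classical_sets filter.

(** Every part rests on one remark: joins, relational images and products of
    filters are obtained from each other by restricting to, or composing with,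
    a diagonal-like set, and such sets are principal filters.

    - The join of F and H is the projection of F x H restricted to the diagonal
      of X x X, so products in M give steadiness.
    - The filter F x Y is the image of F under the relation
      x ~ (x, y), and HF is the projection to Y of the join of F x Y
      and H, so steadiness gives composability.
    - F x G is the image of F under the filter generated by the relations
      {(x, (x, y)) | y in V}, V in G, and this filter is itself the image of G
      under the relation y ~ (x, (x, y)), so composability gives products.
    - Filters of the kernel are in M because F is its own image under the
      diagonal.  Conversely, if products are in M, let A be a subset of (X x Y) x Z.  If
      J is F1-composable, A is read as a relation from X to Y x Z, which sends
      F in J to a filter E of J on Y x Z; the image of F x G under A is
      recovered from E x G in M by forcing the two Y-coordinates to agree and
      projecting to Z.  If D is F1-composable, the roles of the two factors are
      exchanged ([products_in_ker_left], [products_in_ker_right]).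

    The computations are short because a set belongs to one of these filters
    exactly when some set described by a universal quantifier belongs to the
    original one ([filter_join_globally], [relimage_globallyE],
    [prod_globallyTE]). *)

Set Implicit Arguments.
Unset Strict Implicit.
Unset Printing Implicit Defensive.

Local Open Scope classical_set_scope.

(** * Principal filters in joins, products and relational images *)

Lemma set_system_ext (X : Type) (F G : set_system X) :
  (forall P, F P <-> G P) -> F = G.
Proof. by move=> FG; apply/funext => P; apply/propext. Qed.

Lemma filter_join_globally (X : Type) (F : set_system X) (B : set X) :
  Filter F -> filter_join F (globally B) = within B F.
Proof.
move=> FF; apply: set_system_ext => P; split.
  move=> [[U V] [/= FU BV] UVP]; rewrite /within /=.
  by apply: filterS FU => x Ux Bx; apply: UVP; split => //; exact: BV.
by move=> FP; exists ([set x | B x -> P x], B) => //= x [+ Bx]; exact.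
Qed.

Lemma relimage_globallyE (X Y : Type) (A : set (X * Y)) (F : set_system X)
    (P : set Y) : Filter F ->
  filter_relimage (globally A) F P <->
  F [set x | forall y, A (x, y) -> P y].
Proof.
move=> FF; split.
  move=> [[A' U] [/= AA' FU] A'UP].
  by apply: filterS FU => x Ux y Axy; apply: A'UP; exists x => //; exact: AA'.
move=> FP; exists (A, [set x | forall y, A (x, y) -> P y]) => //= y.
by move=> [x + Axy]; exact.
Qed.

Lemma prod_globallyTE (X Y : Type) (F : set_system X) (P : set (X * Y)) :
  Filter F ->
  filter_prod F (globally [set: Y]) P <-> F [set x | forall y, P (x, y)].
Proof.
move=> FF; split.
  move=> [[U V] [/= FU TV] UVP].
  by apply: filterS FU => x Ux y; apply: UVP; split => //; exact: TV.
move=> FP; exists ([set x | forall y, P (x, y)], setT) => //= -[x y] [/= + _].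
exact.
Qed.

Lemma meets_globally_prodTP (X Y : Type) (A : set (X * Y))
    (F : set_system X) : Filter F ->
  globally A `#` filter_prod F (globally [set: Y]) <->
  (forall U, F U -> exists x y, U x /\ A (x, y)).
Proof.
move=> FF; split.
  move=> AF U FU; have [//||[x y] [Axy [/= Ux _]]] := AF A (U `*` setT).
    by exists (U, setT).
  by exists x, y.
move=> AF A' W AA' /prod_globallyTE FW.
by have [x [y [Wx Axy]]] := AF _ FW; exists (x, y); split; [exact: AA'|exact: Wx].
Qed.

(** * Stability under restriction and images *)

Lemma F1_globally (X : Type) (A : set X) :
  A !=set0 -> F1 X (globally A).
Proof. by move=> A0; exists A. Qed.

Lemma F1_steady_within (M : filters_class) (X : Type) (F : set_system X)
    (B : set X) :
  F1_steady M -> M X F -> (forall U, F U -> U `&` B !=set0) -> M X (within B F).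
Proof.
move=> Mst MF FB; have FF := mem_class_proper MF.
rewrite -filter_join_globally; apply: Mst => //.
  by apply: F1_globally; have [x [_ Bx]] := FB _ filterT; exists x.
move=> U V FU BV; have [x [Ux Bx]] := FB _ FU.
by exists x; split => //; exact: BV.
Qed.

Lemma F1_composable_relimage (J : filters_class) (X Y : Type)
    (F : set_system X) (A : set (X * Y)) :
  F1_composable J -> J X F ->
  (forall U, F U -> exists x y, U x /\ A (x, y)) ->
  J Y (filter_relimage (globally A) F).
Proof.
move=> Jc JF FA; have FF := mem_class_proper JF.
apply: Jc => //; last exact/meets_globally_prodTP.
by apply: F1_globally; have [x [y [_ Axy]]] := FA _ filterT; exists (x, y).
Qed.

(** * Joins, relational images and products *)

(** The join is the trace of the product on the diagonal. *)
Lemma steady_of_products (J D M : filters_class) :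
  F1_steady M -> projectable M -> products_in J D M -> steady D M J.
Proof.
move=> Mst Mpr JDM X F H JF DH FH.
pose diag : set (X * X) := [set p | p.1 = p.2].
have Mdiag : M (X * X)%type (within diag (filter_prod F H)).
  apply: F1_steady_within (JDM _ _ _ _ JF DH) _ => //.
  move=> W [[U V] [/= FU HV] UVW]; have [x [Ux Vx]] := FH _ _ FU HV.
  by exists (x, x); split => //; exact: UVW.
have [+ _] := Mpr _ _ _ Mdiag; congr (M X _).
apply: set_system_ext => P; split.
  move=> [[U V] UV UVP]; exists (U, V) => // x [Ux Vx].
  exact: (UVP (x, x)).
move=> [[U V] UV UVP]; exists (U, V) => // -[x y] [/= Ux Vy] xy.
by apply: UVP; split => //=; rewrite (xy : x = y).
Qed.

(** The cylinder is the image of F under x ~ (x, y).  The point y0 makes it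
    proper. *)
Lemma F1_composable_cylinder (J : filters_class) (X Y : Type)
    (F : set_system X) (y0 : Y) :
  F1_composable J -> J X F ->
  J (X * Y)%type (filter_prod F (globally [set: Y])).
Proof.
move=> Jc JF; have FF := mem_class_proper JF.
pose A : set (X * (X * Y)) := [set p | p.1 = p.2.1].
have -> : filter_prod F (globally [set: Y]) = filter_relimage (globally A) F.
  apply: set_system_ext => P; rewrite prod_globallyTE relimage_globallyE.
  split; apply: filterS => x /= xP.
    by move=> [x' y] /= xx'; rewrite -(xx' : x = x'); exact: xP.
  by move=> y; exact: xP.
apply: F1_composable_relimage => // U FU.
by have [x Ux] := filter_ex FU; exists x, (x, y0).
Qed.

Lemma composable_of_steady (J D M : filters_class) :
  projectable M -> F1_composable J -> steady D M J -> composable D M J.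
Proof.
move=> Mpr Jc Jst X Y F H JF DH HF.
have FF := mem_class_proper JF; have FH := mem_class_proper DH.
have [[_ y0] _] := HF setT setT filterT filterT.
have JFY := F1_composable_cylinder y0 Jc JF.
have Mjoin : M (X * Y)%type
    (filter_join (filter_prod F (globally [set: Y])) H).
  by apply: Jst => // U V FU HV; rewrite setIC; exact: HF.
have [_ +] := Mpr _ _ _ Mjoin; congr (M Y _).
apply: set_system_ext => P; split.
  move=> [[W V] [/= /prod_globallyTE FW HV] WVP].
  exists (V, [set x | forall y, W (x, y)]) => // y [x Wx Vxy].
  by apply: (WVP (x, y)); split => //; exact: Wx.
move=> [[V U] [/= HV FU] VUP]; exists (U `*` setT, V).
  by split=> //=; exists (U, setT).
by move=> [x y] [[/= Ux _] Vxy]; apply: VUP; exists x.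
Qed.

(** F x G is the image of F under the filter generated by the relations
    {(x, (x, y)) | y in V}, V in G, and that filter is in D. *)
Lemma products_of_composable (J D M : filters_class) :
  F1_composable D -> composable D M J -> products_in J D M.
Proof.
move=> Dc Jc X Y F G JF DG.
have FF := mem_class_proper JF; have FG := mem_class_proper DG.
have [x0 _] := filter_ex (filterT (F := F)).
pose A : set (Y * (X * (X * Y))) := [set p | p.2 = (p.2.1, (p.2.1, p.1))].
pose H := filter_relimage (globally A) G.
have DH : D (X * (X * Y))%type H.
  apply: F1_composable_relimage => // V GV.
  by have [y Vy] := filter_ex GV; exists y, (x0, (x0, y)).
have HE W : H W <-> G [set y | forall x, W (x, (x, y))].
  rewrite /H relimage_globallyE; split; apply: filterS => y /= yW.
    by move=> x; exact: yW.
  by move=> [x [x' y']]; rewrite /A /= => -[-> ->]; exact: yW.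
have HF : H `#` filter_prod F (globally [set: X * Y]).
  move=> W U /HE GW /prod_globallyTE FU.
  have [y Wy] := filter_ex GW; have [x Ux] := filter_ex FU.
  by exists (x, (x, y)); split; [exact: Wy|exact: Ux].
have := Jc _ _ _ _ JF DH HF; congr (M _ _).
apply: set_system_ext => P; split.
  move=> [[W U] [/= /HE GW FU] WUP].
  exists (U, [set y | forall x, W (x, (x, y))]) => // -[x y] [/= Ux Wy].
  by apply: WUP; exists x => //; exact: Wy.
move=> [[U V] [/= FU GV] UVP].
exists ([set p | p.2.1 = p.1 /\ V p.2.2], U).
  by split=> //=; apply/HE; apply: filterS GV => y Vy x.
by move=> [x' y] [x Ux /= [-> Vy]]; exact: UVP.
Qed.

(** * Products and the kernel *)

(** A filter is its own image under the diagonal. *)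
Lemma ker_sub (M : filters_class) (X : Type) (F : set_system X) :
  ker M X F -> M X F.
Proof.
move=> [FF kF]; pose diag : set (X * X) := [set p | p.1 = p.2].
have : M X (filter_relimage (globally diag) F).
  apply: kF; apply/meets_globally_prodTP => U FU.
  by have [x Ux] := filter_ex FU; exists x, x.
congr (M X _); apply: set_system_ext => P; rewrite relimage_globallyE.
split; apply: filterS => x /=; first exact.
by move=> Px y; rewrite /diag /= => <-.
Qed.

(** A is curried into a relation from X to Y * Z, applied to the factor in J;
    the resulting filter remembers the coordinate y, which is then matched
    against the factor in D. *)
Lemma products_in_ker_left (J D M : filters_class) :
  F1_steady M -> projectable M -> F1_composable J ->
  products_in J D M -> products_in J D (ker M).
Proof.
move=> Mst Mpr Jc JDM X Y F G JF DG.
have FF := mem_class_proper JF; have FG := mem_class_proper DG.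
have FFG := mem_class_proper (JDM _ _ _ _ JF DG).
split=> // Z A /meets_globally_prodTP AFG.
have {}AFG U V : F U -> G V ->
    exists x y z, [/\ U x, V y & A ((x, y), z)].
  move=> FU GV; have [|[x y] [z [[/= Ux Vy] Axyz]]] := AFG (U `*` V).
    by exists (U, V).
  by exists x, y, z.
pose A' : set (X * (Y * Z)) := [set p | A ((p.1, p.2.1), p.2.2)].
pose E := filter_relimage (globally A') F.
have JE : J (Y * Z)%type E.
  apply: F1_composable_relimage => // U FU.
  have [x [y [z [Ux _ Axyz]]]] := AFG _ _ FU filterT.
  by exists x, (y, z).
pose B : set ((Y * Z) * Y) := [set q | q.1.1 = q.2].
have MB : M ((Y * Z) * Y)%type (within B (filter_prod E G)).
  apply: F1_steady_within (JDM _ _ _ _ JE DG) _ => //.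
  move=> W [[U V] [/= /relimage_globallyE FU GV] UVW].
  have [x [y [z [Ux Vy Axyz]]]] := AFG _ _ FU GV.
  exists ((y, z), y); split => //; apply: UVW; split => //.
  exact: Ux.
have [/Mpr[_ +] _] := Mpr _ _ _ MB; congr (M Z _).
apply: set_system_ext => P; rewrite relimage_globallyE; split.
  move=> [[U V] [/= /relimage_globallyE FU GV] UVP].
  exists ([set x | forall p, A' (x, p) -> U p], V) => //.
  move=> [x y] [/= Ux Vy] z Axyz.
  by apply: (UVP ((y, z), y)) => //; split => //; exact: Ux.
move=> [[S T] [/= FS GT] STP].
exists (rel_image A' S, T).
  split=> //=; apply/relimage_globallyE.
  by apply: filterS FS => x Sx p Axp; exists x.
move=> [[y z] y'] [/= [x Sx Axyz] Ty'] /= yy'.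
by apply: (STP (x, y)) => //; split => //=; rewrite (yy' : y = y').
Qed.

(** The same with the factor in D as the source of the relation.  This is not
    an instance of [products_in_ker_left], as M need not be stable under the
    exchange of factors. *)
Lemma products_in_ker_right (J D M : filters_class) :
  F1_steady M -> projectable M -> F1_composable D ->
  products_in J D M -> products_in J D (ker M).
Proof.
move=> Mst Mpr Dc JDM X Y F G JF DG.
have FF := mem_class_proper JF; have FG := mem_class_proper DG.
have FFG := mem_class_proper (JDM _ _ _ _ JF DG).
split=> // Z A /meets_globally_prodTP AFG.
have {}AFG U V : F U -> G V ->
    exists x y z, [/\ U x, V y & A ((x, y), z)].
  move=> FU GV; have [|[x y] [z [[/= Ux Vy] Axyz]]] := AFG (U `*` V).
    by exists (U, V).
  by exists x, y, z.
pose A' : set (Y * (X * Z)) := [set p | A ((p.2.1, p.1), p.2.2)].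
pose E := filter_relimage (globally A') G.
have DE : D (X * Z)%type E.
  apply: F1_composable_relimage => // V GV.
  have [x [y [z [_ Vy Axyz]]]] := AFG _ _ filterT GV.
  by exists y, (x, z).
pose B : set (X * (X * Z)) := [set q | q.1 = q.2.1].
have MB : M (X * (X * Z))%type (within B (filter_prod F E)).
  apply: F1_steady_within (JDM _ _ _ _ JF DE) _ => //.
  move=> W [[U V] [/= FU /relimage_globallyE GV] UVW].
  have [x [y [z [Ux Vy Axyz]]]] := AFG _ _ FU GV.
  exists (x, (x, z)); split => //; apply: UVW; split => //.
  exact: Vy.
have [_ /Mpr[_ +]] := Mpr _ _ _ MB; congr (M Z _).
apply: set_system_ext => P; rewrite relimage_globallyE; split.
  move=> [[U V] [/= FU /relimage_globallyE GV] UVP].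
  exists (U, [set y | forall p, A' (y, p) -> V p]) => //.
  move=> [x y] [/= Ux Vy] z Axyz.
  by apply: (UVP (x, (x, z))) => //; split => //; exact: Vy.
move=> [[S T] [/= FS GT] STP].
exists (S, rel_image A' T).
  split=> //=; apply/relimage_globallyE.
  by apply: filterS GT => y Ty p Ayp; exists y.
move=> [x' [x z]] [/= Sx' [y Ty Axyz]] /= xx'.
by apply: (STP (x, y)) => //; split => //=; rewrite -(xx' : x' = x).
Qed.

Theorem theorem20 (J D M : filters_class) :
  [/\ (F1_steady M -> projectable M ->
         products_in J D M -> steady D M J),
      (projectable M -> F1_composable J ->
         steady D M J -> composable D M J),
      (F1_composable D ->
         composable D M J -> products_in J D M)
    & (F1_steady M -> projectable M ->
         F1_composable D \/ F1_composable J ->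
         (products_in J D M <-> products_in J D (ker M)))].
Proof.
split.
- exact: steady_of_products.
- exact: composable_of_steady.
- exact: products_of_composable.
- move=> Mst Mpr DJc; split.
    case: DJc => [Dc|Jc]; first exact: products_in_ker_right.
    exact: products_in_ker_left.
  by move=> JDk X Y F G JF DG; apply: ker_sub; exact: JDk.
Qed.
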